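(* Let $\Delta$ be a homology $(d-1)$-sphere and $1\leq r\leq \frac{d+1}{2}$ an integer. (i) If $\Delta(d-r)$ is a homology $d$-ball with $\partial \Delta(d-r)=\Delta$ then it is $(r-1)$-stacked. (ii) If $\Delta'$ is an $(r-1)$-stacked homology $d$-ball with $\partial \Delta'=\Delta$ then $\Delta'=\Delta(d-r)$.
   Context: Homology spheres and balls are over a fixed field $k$: a $d$-dimensional complex $\Delta$ is a homology $d$-sphere if for every face $F$ (including $\emptyset$), $\widetilde H_{d-\#F-i}(\mathrm{lk}_\Delta(F);k)$ is $k$ for $i=0$ and vanishes for $i>0$; a homology $d$-ball has these groups equal to $k$ or $0$ for $i=0$ and vanishing for $i>0$, with boundary $\partial\Delta=\{F: \widetilde H_{d-\#F}(\mathrm{lk}_\Delta(F);k)=0\}$ a homology $(d-1)$-sphere. A homology $d$-ball is $(r-1)$-stacked if it has no interior faces (faces not in $\partial\Delta$) of dimension $\leq d-r$. For a complex $\Delta$ on vertex set $V$, $\Delta(i):=\{F\subseteq V:\text{all subsets of }F\text{ of size}\leq i+1\text{ are in }\Delta\}$. *)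

(* Defs.v *)
From HB Require Import structures.
From mathcomp Require Import all_boot all_order all_algebra.

Set Implicit Arguments.
Unset Strict Implicit.
Unset Printing Implicit Defensive.

Import Order.TTheory GRing.Theory Num.Theory.
Local Open Scope ring_scope.

Section Complexes.
Variable V : finType.
Implicit Types (D : {set {set V}}) (F G : {set V}).

(* The ambient type V may contain points that are not vertices of D.  The void
   family is not a complex: the empty face is always present. *)
Definition is_complex D : Prop :=
  set0 \in D /\ forall F G, F \in D -> G \subset F -> G \in D.

Definition vertices D : {set V} := [set v | [set v] \in D].

Definition fdim F : int := #|F|%:Z - 1.

Definition cdim D : int := (\max_(F in D) #|F|)%N%:Z - 1.

Definition link D F : {set {set V}} :=
  [set G : {set V} | [disjoint G & F] && (G :|: F \in D)].

(* The complex written D(i). *)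
Definition fill D (i : int) : {set {set V}} :=
  [set F : {set V} | (F \subset vertices D)
    && [forall G : {set V}, (G \subset F) && (#|G|%:Z <= i + 1) ==> (G \in D)]].

End Complexes.

Section Homology.
Variables (k : fieldType) (V : finType).
Implicit Types (D : {set {set V}}) (F G : {set V}) (j : int).

(* All simplices on V live in one space; faces are oriented by the enumeration
   order of V. *)
Local Notation chain := {ffun {set V} -> k^o}.

Definition simplex F : chain := [ffun G => (G == F)%:R].

Definition incidence F (x : V) : k :=
  (-1) ^+ #|[set y in F | (enum_rank y < enum_rank x)%N]|.

Definition bdry (c : chain) : chain :=
  \sum_(F : {set V}) \sum_(x in F) (c F * incidence F x) *: simplex (F :\ x).

Fact bdry_is_linear : linear bdry.
Proof.
move=> a u v; rewrite /bdry scaler_sumr -big_split /=; apply: eq_bigr => F _.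
rewrite scaler_sumr -big_split /=; apply: eq_bigr => x _.
by rewrite !ffunE scalerA -scalerDl mulrDl mulrA.
Qed.

HB.instance Definition _ :=
  GRing.isLinear.Build k chain chain _ bdry bdry_is_linear.

(* The empty face spans the chains of degree -1, so homology is reduced;
   chains of degree less than -1 are zero. *)
Definition chains D j : {vspace chain} :=
  <<[seq simplex F | F <- enum D & fdim F == j]>>%VS.

Definition cycles D j : {vspace chain} :=
  (chains D j :&: lker (linfun bdry))%VS.

Definition boundaries D j : {vspace chain} :=
  (linfun bdry @: chains D (j + 1))%VS.

(* A complement of the boundaries in the cycles represents the quotient
   Z_j / B_j, see [boundaries_sub_cycles] and [dim_rhomology]. *)
Definition rhomology D j : {vspace chain} := (cycles D j :\: boundaries D j)%VS.

Definition homology_sphere (d : int) D : Prop :=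
  [/\ is_complex D, cdim D = d &
    forall F, F \in D ->
      \dim (rhomology (link D F) (d - #|F|%:Z)) = 1%N /\
      forall i : nat, (0 < i)%N ->
        rhomology (link D F) (d - #|F|%:Z - i%:Z) = 0%VS].

Definition boundary D : {set {set V}} :=
  [set F in D | rhomology (link D F) (cdim D - #|F|%:Z) == 0%VS].

Definition homology_ball (d : int) D : Prop :=
  [/\ is_complex D, cdim D = d,
    forall F, F \in D ->
      (\dim (rhomology (link D F) (d - #|F|%:Z)) = 1%N \/
       rhomology (link D F) (d - #|F|%:Z) = 0%VS) /\
      forall i : nat, (0 < i)%N ->
        rhomology (link D F) (d - #|F|%:Z - i%:Z) = 0%VS &
    homology_sphere (d - 1) (boundary D)].

(* For s = r - 1 the bound on dimensions is d - r. *)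
Definition stacked_ball (s d : int) D : Prop :=
  homology_ball d D /\
  forall F, F \in D -> F \notin boundary D -> ~ (fdim F <= d - (s + 1)).

Lemma bdry_simplex F :
  bdry (simplex F) = \sum_(x in F) incidence F x *: simplex (F :\ x).
Proof.
rewrite /bdry (bigD1 F) //= [X in _ + X]big1 ?addr0; last first.
  move=> G /negPf nGF; apply: big1 => x _.
  by rewrite ffunE nGF mul0r scale0r.
by apply: eq_bigr => x _; rewrite ffunE eqxx mul1r.
Qed.

Lemma incidence_anti F x y : x \in F -> y \in F -> x != y ->
  incidence F x * incidence (F :\ x) y = - (incidence F y * incidence (F :\ y) x).
Proof.
wlog lt_xy : x y / (enum_rank x < enum_rank y)%N => [IH xF yF nxy|].
  case: (ltngtP (enum_rank x) (enum_rank y)) => [lt|lt|/val_inj/enum_rank_inj eq].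
  - exact: IH.
  - by rewrite [in RHS]IH ?opprK // eq_sym.
  - by rewrite eq eqxx in nxy.
move=> xF yF nxy; rewrite /incidence.
have -> : [set z in F :\ y | (enum_rank z < enum_rank x)%N]
        = [set z in F | (enum_rank z < enum_rank x)%N].
  apply/setP => z; rewrite !inE; have [->|//] := eqVneq z y.
  by rewrite [(enum_rank y < _)%N]ltnNge (ltnW lt_xy) !andbF.
have := cardsD1 x [set z in F | (enum_rank z < enum_rank y)%N].
rewrite inE xF lt_xy /= add1n => ->.
have -> : [set z in F | (enum_rank z < enum_rank y)%N] :\ x
        = [set z in F :\ x | (enum_rank z < enum_rank y)%N].
  by apply/setP => z; rewrite !inE andbA.
by rewrite exprS mulN1r mulNr opprK mulrC.
Qed.

Lemma bdry_bdry (c : chain) : bdry (bdry c) = 0.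
Proof.
have bb F : bdry (bdry (simplex F)) = 0.
  pose T x y : chain :=
    (incidence F x * incidence (F :\ x) y) *: simplex (F :\ x :\ y).
  pose P x y := [&& x \in F, y \in F & (enum_rank y < enum_rank x)%N].
  have -> : bdry (bdry (simplex F)) =
      \sum_x \sum_(y | P x y) T x y + \sum_x \sum_(y | P y x) T x y.
    rewrite bdry_simplex linear_sum /= -big_split /= big_mkcond /=.
    apply: eq_bigr => x _; case: ifP => xF; last first.
      by rewrite !big_pred0 ?addr0 // => y; rewrite /P xF ?andbF.
    rewrite linearZ /= bdry_simplex scaler_sumr.
    rewrite (bigID (fun y => enum_rank y < enum_rank x)%N) /=.
    congr (_ + _).
      apply: eq_big => [y|y _]; last by rewrite /T -scalerA.
      by rewrite /P !inE xF /=; case: eqP => [->|_]; rewrite ?ltnn ?andbF.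
    apply: eq_big => [y|y _]; last by rewrite /T -scalerA.
    rewrite /P !inE xF /= -leqNgt leq_eqVlt.
    rewrite (inj_eq val_inj) (inj_eq enum_rank_inj) (eq_sym x).
    by case: (eqVneq y x) => [->|_]; rewrite ?ltnn ?andbF.
  rewrite [X in _ + X](exchange_big_dep predT) //= -big_split /=.
  apply: big1 => x _; rewrite -big_split /=; apply: big1 => y.
  case/and3P=> xF yF ltyx; rewrite /T incidence_anti //; last first.
    by apply: contraTneq ltyx => ->; rewrite ltnn.
  by rewrite scaleNr setDDl setUC -setDDl addNr.
rewrite {2}/bdry linear_sum big1 // => F _.
have -> : \sum_(x in F) (c F * incidence F x) *: (simplex (F :\ x) : chain)
        = c F *: bdry (simplex F).
  rewrite bdry_simplex scaler_sumr; apply: eq_bigr => x _.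
  by rewrite scalerA.
by rewrite linearZ /= bb scaler0.
Qed.

Lemma boundaries_sub_cycles D j :
  is_complex D -> (boundaries D j <= cycles D j)%VS.
Proof.
case=> _ Dsub; rewrite /boundaries limg_span; apply/span_subvP => c.
case/mapP=> u /mapP[F FD ->] ->.
move: FD; rewrite mem_filter mem_enum => /andP[/eqP dF DF].
rewrite memv_cap memv_ker !lfunE /= bdry_bdry eqxx andbT.
rewrite bdry_simplex; apply: memv_suml => x xF; apply/memvZ/memv_span/map_f.
rewrite mem_filter mem_enum (Dsub F) ?subsetDl // andbT.
move: dF; rewrite /fdim (cardsD1 x F) xF add1n -addn1 PoszD addrK => ->.
by rewrite addrK.
Qed.

Lemma dim_rhomology D j : is_complex D ->
  \dim (rhomology D j) = (\dim (cycles D j) - \dim (boundaries D j))%N.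
Proof.
move/(boundaries_sub_cycles j)/capv_idPr=> capE.
by rewrite -(dimv_cap_compl (cycles D j) (boundaries D j)) capE addKn.
Qed.

End Homology.

(* Main.v *)
Require Import Defs.
From mathcomp Require Import all_boot all_order all_algebra.
From mathcomp Require Import zify lra.

Import Order.TTheory GRing.Theory Num.Theory.
Local Open Scope ring_scope.

(** Part (i) is immediate: a face of [Delta(d-r)] of dimension at most [d-r] is
    one of its own small subsets, hence lies in [Delta].  For part (ii), no
    interior face has dimension at most [d-r], so the link of every face of the
    ball is acyclic in degrees at least [r-1].  By a Mayer-Vietoris argument
    this property survives the deletion of a vertex, so all induced subcomplexes
    are acyclic in these degrees.  A minimal nonface [F] with at least [d-r+2]
    vertices would induce the boundary of a simplex, whose fundamental cycle has
    degree [|F|-2 >= d-r >= r-1] and does not bound: a contradiction. *)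

Section Leray.
Variables (k : fieldType) (V : finType).
Implicit Types (D X : {set {set V}}) (F G : {set V}) (j : int).
Local Notation chain := {ffun {set V} -> k^o}.
Implicit Types (c z e : chain).

(** Vanishing homology phrased through explicit cycles and fillings, so that chains can be cut and
    glued by hand; [rhomology_eq0] gives the equivalence. *)
Definition acyclic_at X j : Prop :=
  forall z, z \in chains k X j -> bdry z = 0 ->
  exists2 e, e \in chains k X (j + 1) & bdry e = z.

(** The Leray property, usually defined by acyclicity of all induced subcomplexes. The equivalent
    form on links is the one that a stacked ball supplies directly. *)
Definition leray D (L : int) : Prop :=
  forall F j, F \in D -> L <= j -> acyclic_at (link D F) j.

Definition deletion D (v : V) : {set {set V}} := [set G in D | v \notin G].

Lemma bdryE c G :
  bdry c G = \sum_(x | x \notin G) c (x |: G) * incidence k (x |: G) x.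
Proof.
rewrite /bdry sum_ffunE.
under eq_bigr => F _ do rewrite sum_ffunE.
rewrite (exchange_big_dep predT) //= [RHS]big_mkcond /=.
apply: eq_bigr => x _; case: ifPn => [xG|/negbNE xG].
  rewrite (bigD1 (x |: G)) ?setU11 //= [X in _ + X]big1.
    by rewrite addr0 !ffunE setU1K // eqxx /GRing.scale /= mulr1.
  move=> F /andP[xF neF]; rewrite !ffunE; case: eqP => [GF|_].
    by rewrite GF setD1K // eqxx in neF.
  by rewrite scaler0.
apply: big1 => F xF; rewrite !ffunE; case: eqP => [GF|_].
  by rewrite GF !inE eqxx in xG.
by rewrite scaler0.
Qed.

Lemma chainsP X j c :
  reflect (forall F, c F != 0 -> F \in X /\ fdim F = j) (c \in chains k X j).
Proof.
apply: (iffP idP) => [cX F|cX].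
  pose s := [seq simplex k F | F <- enum X & fdim F == j].
  rewrite (coord_span (X := in_tuple s) cX) sum_ffunE => nz.
  have [i] : exists i : 'I_(size s), (s`_i : chain) F != 0.
    apply/existsP; apply: contraNT nz; rewrite negb_exists => /forallP s0.
    apply/eqP/big1 => i _; rewrite ffunE.
    by move/negPn/eqP: (s0 i) => ->; rewrite scaler0.
  have /mapP[G] := mem_nth 0 (ltn_ord i).
  rewrite mem_filter mem_enum => /andP[/eqP dG GX] ->.
  by rewrite ffunE; case: (eqVneq F G) => [->|_] //; rewrite eqxx.
have -> : c = \sum_F c F *: simplex k F.
  apply/ffunP => G; rewrite sum_ffunE (bigD1 G) //= [X in _ + X]big1.
    by rewrite addr0 !ffunE eqxx /GRing.scale /= mulr1.
  by move=> F /negPf neF; rewrite !ffunE eq_sym neF scaler0.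
apply: memv_suml => F _; have [->|nz] := eqVneq (c F) 0.
  by rewrite scale0r mem0v.
have [FX dF] := cX F nz.
by apply/memvZ/memv_span/map_f; rewrite mem_filter dF eqxx mem_enum.
Qed.

Lemma bdry_neq0 c G : bdry c G != 0 ->
  exists2 x, x \notin G & c (x |: G) != 0.
Proof.
rewrite bdryE => nz; apply/exists_inP; apply: contraNT nz.
rewrite negb_exists_in => /forall_inP c0; apply/eqP/big1 => x /c0/negPn/eqP->.
by rewrite mul0r.
Qed.

Lemma rhomology_eq0 X j :
  rhomology k X j = 0%VS <-> acyclic_at X j.
Proof.
rewrite /rhomology; split=> [/eqP|ac].
  rewrite diffv_eq0 => /subvP sub z zX z0.
  have /sub/memv_imgP[e eX ->] : z \in cycles k X j.
    by rewrite memv_cap zX memv_ker lfunE /= z0 eqxx.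
  by exists e; rewrite ?lfunE.
apply/eqP; rewrite diffv_eq0; apply/subvP => z.
rewrite memv_cap memv_ker lfunE /= => /andP[zX /eqP/(ac z zX)[e eX <-]].
by apply/memv_imgP; exists e; rewrite ?lfunE.
Qed.

Lemma acyclic_at_no_faces X j :
  (forall F, F \in X -> fdim F != j) -> acyclic_at X j.
Proof.
move=> noF z /chainsP zX _; exists 0; rewrite ?mem0v // linear0.
apply/ffunP => F; rewrite ffunE; apply/esym/eqP/negP => /negP /zX[FX /eqP].
exact/negP/noF.
Qed.

(* The Mayer-Vietoris sequence of [X = deletion X v :|: star v], on chains: if
   [z = bdry c] avoids [v] and [r] is the part of [c] avoiding [v], then
   [z - bdry r] is a cycle of the link of [v]. *)
Lemma acyclic_at_deletion X (v : V) j :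
  is_complex X -> acyclic_at X j -> acyclic_at (link X [set v]) j ->
  acyclic_at (deletion X v) j.
Proof.
move=> [_ subX] acX acL z /chainsP zX z0.
have zXX : z \in chains k X j.
  by apply/chainsP => F /zX[]; rewrite inE => /andP[].
have [c /chainsP cX zE] := acX z zXX z0.
pose r : chain := [ffun G : {set V} => if v \in G then 0 else c G].
have rX : r \in chains k (deletion X v) (j + 1).
  apply/chainsP => F; rewrite ffunE; case: ifPn => [_|vF nz].
    by rewrite eqxx.
  by have [FX dF] := cX F nz; rewrite inE FX vF.
pose b := z - bdry r.
have bL : b \in chains k (link X [set v]) j.
  apply/chainsP => G; rewrite /b !ffunE.
  have [vG|vG] := boolP (v \in G).
    have -> : z G = 0.
      by apply/eqP/negP => /negP /zX[]; rewrite inE vG andbF.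
    rewrite bdryE big1 ?subr0 ?eqxx // => x _.
    by rewrite ffunE !inE vG orbT mul0r.
  (* Away from [v] the chains [c] and [r] agree, so only the coface [v |: G] contributes to the
     coefficient of [b] at [G]. *)
  rewrite -zE !bdryE -sumrB (bigD1 v) //= [X in _ + X]big1.
    rewrite addr0 ffunE setU11 mul0r subr0 => nz.
    have nzc : c (v |: G) != 0 by apply: contraNneq nz => ->; rewrite mul0r.
    have [vGX] := cX _ nzc; rewrite /fdim cardsU1 vG => dG.
    by rewrite inE disjoint_sym disjoints1 vG setUC vGX; split=> //; lia.
  move=> x /andP[xG nxv]; rewrite ffunE !inE eq_sym (negPf nxv) (negPf vG) /=.
  by rewrite subrr.
have b0 : bdry b = 0 by rewrite linearB /= z0 bdry_bdry subrr.
have [e /chainsP eL eE] := acL b bL b0.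
exists (r + e); last by rewrite linearD /= eE addrC subrK.
apply: rpredD rX _; apply/chainsP => F /eL[].
rewrite !inE disjoint_sym disjoints1 => /andP[-> FX] ->; split=> //.
by rewrite andbT; apply: subX FX _; apply: subsetUl.
Qed.

Lemma is_complex_deletion D v : is_complex D -> is_complex (deletion D v).
Proof.
case=> D0 sub; split=> [|F G]; first by rewrite inE D0 inE.
rewrite !inE => /andP[FD vF] GF; rewrite (sub F) //=.
by apply: contraNN vF; apply: (subsetP GF).
Qed.

Lemma is_complex_link D F : is_complex D -> F \in D -> is_complex (link D F).
Proof.
case=> _ sub FD; split=> [|G H].
  by rewrite inE set0U FD -setI_eq0 set0I eqxx.
rewrite !inE => /andP[dGF GFD] HG; rewrite (disjointWl HG) //=.
by apply: sub GFD _; apply: setSU.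
Qed.

Lemma link_deletion D v F : v \notin F ->
  link (deletion D v) F = deletion (link D F) v.
Proof.
move=> vF; apply/setP => G; rewrite !inE (negPf vF) orbF.
by rewrite andbA.
Qed.

Lemma link_link D v F : v \notin F ->
  link (link D F) [set v] = link D (v |: F).
Proof.
move=> vF; apply/setP => G; rewrite !inE -!setI_eq0 setIUr setIUl !setU_eq0.
rewrite (_ : [set v] :&: F == set0); last first.
  by rewrite setI_eq0 disjoints1.
by rewrite andbT andbA setUA.
Qed.

Lemma leray_deletion D (L : int) (v : V) :
  is_complex D -> leray D L -> leray (deletion D v) L.
Proof.
move=> cD ler F j; rewrite inE => /andP[FD vF] Lj.
rewrite link_deletion //; apply: acyclic_at_deletion.
- exact: is_complex_link.
- exact: ler.
(* The link of [v] in [link D F] is again a link of a face of [D], unless [v |: F] is a nonface;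
   then it is the void family, which carries no chains. *)
rewrite link_link //; have [vFD|vFD] := boolP (v |: F \in D); first exact: ler.
apply: acyclic_at_no_faces => G; rewrite inE => /andP[_ GD].
by case/negP: vFD; case: cD => _ /(_ _ _ GD); apply; apply: subsetUr.
Qed.

Lemma leray_induced D (L : int) (W : {set V}) :
  is_complex D -> leray D L -> leray [set G in D | G \subset W] L.
Proof.
(* An induced subcomplex arises by deleting the vertices outside [W] one at a time. *)
move=> cD ler; pose E s := foldr (fun v X => deletion X v) D s.
have -> : [set G in D | G \subset W] = E (enum (~: W)).
  have inE_E s G : (G \in E s) = (G \in D) && all (fun v => v \notin G) s.
    elim: s => [|v s IH] /=; first by rewrite andbT.
    by rewrite inE IH -andbA [_ && (v \notin G)]andbC.
  apply/setP => G; rewrite inE_E inE; congr (_ && _).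
  apply/subsetP/allP => [GW v|nG v vG].
    by rewrite mem_enum inE; apply: contraNN => /GW.
  apply: contraLR vG => vW; apply: nG.
  by rewrite mem_enum inE.
suff [] : is_complex (E (enum (~: W))) /\ leray (E (enum (~: W))) L by [].
elim: (enum _) => [|v s [cE lE]] //=.
by split; [apply: is_complex_deletion | apply: leray_deletion].
Qed.

Lemma link_set0 D : link D set0 = D.
Proof. by apply/setP => G; rewrite inE setU0 -setI_eq0 setI0 eqxx. Qed.

Lemma leray_missing_face D (L : int) F : is_complex D -> leray D L ->
  (forall G, G \proper F -> G \in D) -> L <= fdim F - 1 -> F != set0 ->
  F \in D.
Proof.
move=> cD ler FD LF /set0Pn[x xF]; apply: contraT => nFD.
have := leray_induced D L F cD ler; set X := [set G in D | _] => lX.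
have X0 : set0 \in X by rewrite inE sub0set; case: cD => ->.
have := lX _ _ X0 LF; rewrite link_set0 => acX.
have zX : bdry (simplex k F) \in chains k X (fdim F - 1).
  apply/chainsP => G /bdry_neq0[y yG]; rewrite ffunE.
  case: (eqVneq (y |: G) F) => [yGF _|_]; last by rewrite eqxx.
  have GF : G \proper F.
    by rewrite -yGF properE subsetUr subUset sub1set negb_and yG.
  split; first by rewrite inE FD // proper_sub.
  by rewrite /fdim -yGF cardsU1 yG; lia.
have [e /chainsP eX eE] := acX _ zX (bdry_bdry _).
(* A filling has the degree of [F] and is supported on subsets of [F], so its only possible support
   is [F] itself, a nonface. *)
have e0 : e = 0.
  apply/ffunP => G; rewrite ffunE; apply/eqP/negP => /negP /eX[].
  rewrite inE /fdim => /andP[GD GF] cG.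
  have GEF : G = F by apply/eqP; rewrite eqEcard GF; lia.
  by rewrite GEF (negPf nFD) in GD.
(* This coefficient is a sign, hence nonzero, although the filling has just been shown to vanish. *)
have : bdry (simplex k F) (F :\ x) = incidence k F x.
  rewrite bdryE (bigD1 x) /= ?setD11 // setD1K // ffunE eqxx mul1r.
  rewrite big1 ?addr0 // => y /andP[_ nyx]; rewrite ffunE.
  case: eqP => [E|_]; last by rewrite mul0r.
  by move: xF; rewrite -E !inE eqxx eq_sym (negPf nyx).
rewrite -eE e0 linear0 ffunE => /esym/eqP.
by rewrite /incidence signr_eq0.
Qed.
End Leray.

Theorem theorem2p3 (k : fieldType) (V : finType) (Delta : {set {set V}})
    (d r : int) :
  homology_sphere k (d - 1) Delta ->
  1 <= r -> r%:Q <= (d%:Q + 1) / 2%:Q ->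
  (homology_ball k d (fill Delta (d - r)) ->
   boundary k (fill Delta (d - r)) = Delta ->
   stacked_ball k (r - 1) d (fill Delta (d - r)))
  /\
  (forall Delta' : {set {set V}},
   stacked_ball k (r - 1) d Delta' ->
   boundary k Delta' = Delta ->
   Delta' = fill Delta (d - r)).
Proof.
move=> sphD r1 rd.
have {}rd : r * 2 <= d + 1.
  rewrite -(ler_int rat) rmorphM rmorphD /=; lra.
split=> [ballF bF|D' [ballD' stD'] bD'].
  split=> // F FF; rewrite bF => FD dF; case/negP: FD.
  move: FF; rewrite inE => /andP[_ /forallP/(_ F)/implyP]; apply.
  by rewrite subxx; move: dF; rewrite /fdim; lia.
have small F : F \in D' -> #|F|%:Z <= d - r + 1 -> F \in Delta.
  move=> FD' cF; rewrite -bD'; apply: contraT => /(stD' F FD'); case.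
  by rewrite /fdim; lia.
have [cD' dD' lkD' _] := ballD'.
have [_ subD'] := cD'.
have DD' F : F \in Delta -> F \in D' by rewrite -bD' inE => /andP[].
(* Below degree [d - #|F|] the ball axioms give vanishing; above it the link has no faces. *)
have ler : leray k V D' (r - 1).
  move=> F j FD' rj; have [_ low] := lkD' F FD'.
  have [lt|gt|eqj] := ltgtP j (d - #|F|%:Z).
  - apply/rhomology_eq0; rewrite -(low (absz (d - #|F|%:Z - j)%R)); last by lia.
    by congr rhomology; lia.
  - apply: acyclic_at_no_faces => G; rewrite inE => /andP[dGF GFD].
    have : (#|G :|: F| <= \max_(H in D') #|H|)%N by rewrite leq_bigmax_cond.
    have := cardsUI G F; rewrite disjoint_setI0 // cards0.
    by move: dD'; rewrite /cdim /fdim; lia.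
  (* In the top degree, [r - 1 <= d - #|F|] says that [F] has dimension at most [d - r]. So [F] is a
     boundary face, and its top link homology vanishes by definition. *)
  apply/rhomology_eq0.
  have : F \in boundary k D'.
    apply: contraT => /(stD' F FD'); case; rewrite /fdim; lia.
  by rewrite inE FD' dD' -eqj => /eqP.
apply/eqP; rewrite eqEsubset; apply/andP; split; apply/subsetP => F.
  move=> FD'; rewrite inE; apply/andP; split.
    apply/subsetP => x xF; rewrite inE; apply: small.
      by apply: subD' FD' _; rewrite sub1set.
    by rewrite cards1; lia.
  apply/forallP => G; apply/implyP => /andP[GF]; apply: small.
  exact: subD' FD' GF.
(* Strong induction on the size of [F] puts all its proper subsets in [D'], as [leray_missing_face]
   requires. *)
have [n] := ubnP #|F|; elim: n F => // n IH F leFn FF.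
have [le|gt] := lerP #|F|%:Z (d - r + 1).
  apply: DD'; move: FF; rewrite inE => /andP[_ /forallP/(_ F)/implyP]; apply.
  by rewrite subxx.
apply: (@leray_missing_face k _ _ (r - 1)) => //.
- move=> G GF; apply: IH.
    by apply: leq_trans (proper_card GF) _.
  have GsF := proper_sub GF.
  move: FF; rewrite !inE => /andP[FV /forallP FG]; rewrite (subset_trans GsF) //=.
  apply/forallP => H; apply/implyP => /andP[HG cH].
  by move/implyP: (FG H); apply; rewrite (subset_trans HG).
(* Since [#|F| >= d - r + 2], the degree [#|F| - 2] is at least [d - r], which is at least [r - 1]
   because [r * 2 <= d + 1]. *)
- by rewrite /fdim; lia.
- by rewrite -card_gt0; lia.
Qed.
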